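(* Let $\mathbf{H}$ be a hyperplane in $\mathbb{R}^n$ whose $\beta$-neighborhood contains a subset $S$ of vertices of $\{-1,1\}^n$ with $|S|=\alpha\cdot 2^n$. Then there exists a hyperplane which passes through all the points of $\{-1,1\}^n\cup\{0,1\}^n$ that are contained in the $\beta$-neighborhood of $\mathbf{H}$, provided that $$0\le\beta\le\Big((2/\alpha)\cdot n^{5+\lfloor\log(n/\alpha)\rfloor}\cdot(2+\lfloor\log(n/\alpha)\rfloor)!\Big)^{-1}.$$
   Context: The $\beta$-neighborhood of a hyperplane $\mathbf{H}$ in $\mathbb{R}^n$ is the set of points at Euclidean distance at most $\beta$ from $\mathbf{H}$. Logarithms are base 2. *)

(* Defs.v *)
From mathcomp Require Import all_boot all_order all_algebra.
From mathcomp Require Import all_classical all_reals all_analysis.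
Set Implicit Arguments. Unset Strict Implicit. Unset Printing Implicit Defensive.
Import Order.TTheory GRing.Theory Num.Theory.
Local Open Scope ring_scope.

Section Defs.
Variable R : realType.

Definition dotv (n : nat) (u v : 'rV[R]_n) : R := \sum_(i < n) u 0 i * v 0 i.

(* Euclidean distance from x to the hyperplane {y | <w,y> = t}, w <> 0 *)
Definition hdist (n : nat) (w : 'rV[R]_n) (t : R) (x : 'rV[R]_n) : R :=
  `|dotv w x - t| / Num.sqrt (dotv w w).

Definition in_nbhd (n : nat) (beta : R) (w : 'rV[R]_n) (t : R) (x : 'rV[R]_n) :=
  hdist w t x <= beta.

Definition pm1 (n : nat) (b : {ffun 'I_n -> bool}) : 'rV[R]_n :=
  \row_i (if b i then 1 else -1).

Definition in_pm1_cube (n : nat) (x : 'rV[R]_n) := forall i, x 0 i = 1 \/ x 0 i = -1.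
Definition in_01_cube (n : nat) (x : 'rV[R]_n) := forall i, x 0 i = 0 \/ x 0 i = 1.

Definition log2 (x : R) : R := ln x / ln 2.

Definition beta_bound (n : nat) (alpha : R) : R :=
  let k := Num.truncn (log2 (n%:R / alpha)) in
  ((2 / alpha) * n%:R ^+ (5 + k) * ((2 + k)`!)%:R)^-1.

End Defs.

(* Main.v *)
(** Put b = beta |w| and let J be a maximal set of coordinates such that
    b < |<w,a>| for every nonzero a in {-1,0,1}^n supported on J. Two points of S
    that agree outside J differ by 2a for such an a, so |S| <= 2^(n - |J|) and
    |J| <= log(1/alpha). By maximality every w_i is within b of a
    {-1,0,1}-combination of the w_j, j in J; hence w is close to u A, with u the
    restriction of w to J and A a |J| x n matrix over {-1,0,1}. The vectors
    A (x - x0), for x in the neighbourhood, are integral with entries at most 2n.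
    If some v <> 0 is orthogonal to all of them, v A is the required normal vector.
    Otherwise |J| of them form a matrix of determinant at least 1 in absolute value,
    and Cramer's rule bounds u, hence w, by less than |w|, which is absurd. *)
Require Import Defs.
From mathcomp Require Import all_boot all_order all_algebra.
From mathcomp Require Import all_classical all_reals all_analysis.
From mathcomp Require Import perm ring lra.
Import Order.TTheory GRing.Theory Num.Theory.
Local Open Scope ring_scope.

(** * Determinants of integer matrices and Cramer's rule *)

Lemma det_norm_le (R : numDomainType) (m : nat) (M : 'M[R]_m) (B : R) :
  (forall i j, `|M i j| <= B) -> `|\det M| <= m`!%:R * B ^+ m.
Proof.
move=> MB; apply: le_trans (ler_norm_sum _ _ _) _.
apply: (@le_trans _ _ (\sum_(s : 'S_m) B ^+ m)).
  apply: ler_sum => s _; rewrite normrM normrX normrN1 expr1n mul1r normr_prod.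
  rewrite -[in leRHS](card_ord m) -prodr_const.
  by apply: ler_prod => i _; rewrite normr_ge0 MB.
by rewrite sumr_const card_Sn mulr_natl.
Qed.

Lemma det_int (R : archiRealDomainType) (m : nat) (M : 'M[R]_m) :
  (forall i j, M i j \is a Num.int) -> \det M \is a Num.int.
Proof.
move=> Mint; apply: rpred_sum => s _; apply: rpredM; last by apply: rpred_prod.
by rewrite rpredX ?rpredN ?rpred1.
Qed.

(** A nonzero integer determinant has absolute value at least 1, so [v] is no larger than
    [\adj Z *m (Z *m v)]. Each cofactor is at most [d.-1]! times [B ^+ d.-1]; summing [d] of them
    produces [d]!. *)
Lemma cramer_norm_le (R : archiRealFieldType) (d : nat) (Z : 'M[R]_d)
    (v : 'cV[R]_d) (B c : R) :
  Z \in unitmx -> (forall i j, Z i j \is a Num.int) ->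
  (forall i j, `|Z i j| <= B) -> (forall i, `|(Z *m v) i 0| <= c) ->
  forall j, `|v j 0| <= d`!%:R * B ^+ d.-1 * c.
Proof.
case: d => [|d] in Z v *; first by move=> _ _ _ _ [].
rewrite unitmxE unitfE => detZ0 Zint ZB Zc j.
have det1 : 1 <= `|\det Z| by rewrite norm_intr_ge1 ?det_int.
have /matrixP/(_ j 0) : \det Z *: v = \adj Z *m (Z *m v).
  by rewrite mulmxA mul_adj_mx mul_scalar_mx.
rewrite mxE [RHS]mxE => /(congr1 Num.norm); rewrite normrM => detv.
apply: (@le_trans _ _ (`|\det Z| * `|v j 0|)); first by rewrite ler_peMl.
rewrite detv; apply: le_trans (ler_norm_sum _ _ _) _.
apply: (@le_trans _ _ (\sum_(i < d.+1) (d`!%:R * B ^+ d * c))).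
  apply: ler_sum => i _; rewrite normrM ler_pM ?normr_ge0 ?Zc //.
  rewrite mxE normrM normrX normrN1 expr1n mul1r det_norm_le // => k l.
  by rewrite !mxE ZB.
by rewrite sumr_const card_ord factS natrM -[leLHS]mulr_natl !mulrA.
Qed.

(** If the columns of [Z] are independent, some [d] of its rows form an invertible matrix, to which
    Cramer's bound applies; otherwise [Z] has a nonzero kernel vector. *)
Lemma annihilator_or_small (R : archiRealFieldType) (m d : nat)
    (Z : 'M[R]_(m, d)) (v : 'cV[R]_d) (B c : R) :
  (forall i j, Z i j \is a Num.int) -> (forall i j, `|Z i j| <= B) ->
  (forall i, `|(Z *m v) i 0| <= c) ->
  (exists2 v' : 'cV[R]_d, v' != 0 & Z *m v' = 0) \/
  forall j, `|v j 0| <= d`!%:R * B ^+ d.-1 * c.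
Proof.
move=> Zint ZB Zc; have [Zfull|Zdef] := boolP (row_full Z); [right|left].
  have := mxrank_fullrowsub Zfull => fullZ.
  have entry i : (rowsub (fullrankfun Zfull) Z *m v) i 0 =
      (Z *m v) (fullrankfun Zfull i) 0.
    by rewrite !mxE; apply: eq_bigr => j _; rewrite !mxE.
  apply: (@cramer_norm_le _ _ (rowsub (fullrankfun Zfull) Z)).
  - by rewrite -row_free_unit /row_free fullZ.
  - by move=> i j; rewrite mxE.
  - by move=> i j; rewrite mxE.
  - by move=> i; rewrite entry.
(* [kermx] is a left kernel, hence the passage to the transpose. *)
move: Zdef; rewrite /row_full -mxrank_tr -[_ == d]/(row_free Z^T) -kermx_eq0.
case/rowV0Pn => y /sub_kermxP yZ y0; exists y^T; first by rewrite trmx_eq0.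
by rewrite -[Z]trmxK -trmx_mul yZ trmx0.
Qed.

(** * Dissociated sets of coordinates *)

Section Dissociated.
Variables (R : realType) (n : nat).
Implicit Types (w a x : 'rV[R]_n) (b t : R) (J : {set 'I_n}).

Definition trit (x : R) := (x \is a Num.int) && (`|x| <= 1).

Lemma trit_nat (c : bool) : trit c%:R.
Proof. by rewrite /trit rpred_nat; case: c; rewrite ?normr1 ?normr0 ?ler01 /=. Qed.

Lemma tritM (x y : R) : trit x -> trit y -> trit (x * y).
Proof.
move=> /andP[xi x1] /andP[yi y1]; rewrite /trit rpredM //= normrM.
by rewrite mulr_ile1.
Qed.

Lemma tritN (x : R) : trit x -> trit (- x).
Proof. by rewrite /trit rpredN normrN. Qed.

Lemma trit_sqr (x : R) : trit x -> x != 0 -> x * x = 1.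
Proof.
move=> /andP[xi x1] x0; rewrite -expr2 -real_normK ?num_real//.
suff -> : `|x| = 1 by rewrite expr1n.
by apply/eqP; rewrite eq_le x1 norm_intr_ge1.
Qed.

Lemma dotvDr w x y : dotv w (x + y) = dotv w x + dotv w y.
Proof.
by rewrite -big_split; apply: eq_bigr => i _; rewrite mxE mulrDr.
Qed.

Lemma dotvNr w x : dotv w (- x) = - dotv w x.
Proof. by rewrite -sumrN; apply: eq_bigr => i _; rewrite mxE mulrN. Qed.

Lemma dotvZr w c x : dotv w (c *: x) = c * dotv w x.
Proof. by rewrite mulr_sumr; apply: eq_bigr => i _; rewrite mxE mulrCA. Qed.

(** A robust version, with threshold [b], of the dissociated sets of additive combinatorics, for the
    family of coordinates of [w]. *)
Definition dissociated b w J :=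
  forall a, (forall i, trit (a 0 i)) -> (forall i, i \notin J -> a 0 i = 0) ->
  a != 0 -> b < `|dotv w a|.

Lemma dissociated_card b w t J (S : {set {ffun 'I_n -> bool}}) :
  dissociated b w J -> (forall e, e \in S -> `|dotv w (pm1 R e) - t| <= b) ->
  (#|S| <= 2 ^ #|~: J|)%N.
Proof.
move=> Jdis Sb.
(* Erasing the coordinates in [J] is injective on [S]: a collision would give [a] with
   [2 * dotv w a] at most [2 * b] in absolute value. *)
pose clear (e : {ffun 'I_n -> bool}) := [ffun i => (i \notin J) && e i].
have <- : #|clear @: S| = #|S|.
  apply: card_in_imset => e e' /Sb eb /Sb e'b /ffunP ee'.
  pose a : 'rV[R]_n := \row_i ((e i)%:R - (e' i)%:R).
  have a2 : pm1 R e - pm1 R e' = 2 *: a.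
    by apply/rowP => i; rewrite !mxE; case: (e i); case: (e' i); rewrite /=; ring.
  have [a0|a0] := eqVneq a 0.
    apply/ffunP => i; move/rowP/(_ i)/eqP: a0.
    by rewrite !mxE subr_eq0 eqr_nat; case: (e i); case: (e' i).
  suff /(Jdis a) : forall i, trit (a 0 i).
    have Ja i : i \notin J -> a 0 i = 0.
      by move=> iJ; have := ee' i; rewrite !ffunE mxE iJ /= => ->; rewrite subrr.
    move=> /(_ Ja a0) ba.
    have /(congr1 (dotv w)) := a2; rewrite dotvDr dotvNr dotvZr => wa.
    exfalso; clear a2; move: eb e'b ba; rewrite !ler_norml ltr_normr.
    by move=> /andP[? ?] /andP[? ?] /orP[] ?; lra.
  move=> i; rewrite mxE /trit rpredB ?rpred_nat //=.
  case: (e i); case: (e' i);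
  by rewrite ?subrr ?subr0 ?sub0r ?normrN ?normr0 ?normr1.
have -> : (2 ^ #|~: J| = #|pffun_on false (~: J) [pred b : bool | true]|)%N.
  by rewrite card_pffun_on -[in LHS]card_bool.
apply: subset_leq_card; apply/fintype.subsetP => _ /imsetP[e _ ->].
apply/pffun_onP; split => [|//]; apply/supportP => i.
by rewrite inE negbK ffunE => ->.
Qed.

(** [J] is a maximal dissociated set. The identity block of [A] on the columns in [J] ensures that a
    nonzero combination of the rows of [A] is nonzero. *)
Lemma dissociated_lift b w : 0 <= b ->
  exists (J : {set 'I_n}) (A : 'M[R]_(#|J|, n)), [/\ dissociated b w J,
    forall j i, trit (A j i), forall j l, A j (enum_val l) = (j == l)%:R &
    forall i, `|w 0 i - \sum_j w 0 (enum_val j) * A j i| <= b].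
Proof.
move=> b0.
have dis0 : `[< dissociated b w finset.set0 >].
  apply/asboolP => a _ a0 /eqP[]; apply/rowP => i.
  by rewrite mxE a0 ?inE.
have [J /maxsetP[/asboolP Jdis Jmax] _] :=
  @maxset_exists _ (fun J => `[< dissociated b w J >]) _ dis0.
have rel i : exists y : 'cV[R]_#|J|, [/\ forall j, trit (y j 0),
    forall l, i = enum_val l -> forall j, y j 0 = (j == l)%:R &
    `|w 0 i - \sum_j w 0 (enum_val j) * y j 0| <= b].
  have [iJ|iJ] := boolP (i \in J).
    exists (\col_j (j == enum_rank_in iJ i)%:R); split => [j|l il j|].
    - by rewrite mxE trit_nat.
    - have -> : enum_rank_in iJ i = l by apply: enum_val_inj; rewrite enum_rankK_in.
      by rewrite mxE.
    - rewrite (bigD1 (enum_rank_in iJ i)) //= mxE eqxx mulr1 enum_rankK_in //.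
      rewrite big1 ?addr0 ?subrr ?normr0 // => j /negPf ji.
      by rewrite mxE ji mulr0.
  (* By maximality, adding [i] destroys dissociation; [a] is a witness of this. *)
  have /existsNP[a /not_implyP[at' /not_implyP[aJ /not_implyP[a0 ab]]]] :
      ~ dissociated b w (i |: J).
    move=> /asboolP /Jmax /(_ (finset.subsetUr _ _)) iJE.
    by move: iJ; rewrite -iJE finset.setU11.
  have ai0 : a 0 i != 0.
    apply: contra_not_neq ab => ai; apply: Jdis => // l lJ.
    have [->//|li] := eqVneq l i.
    by apply: aJ; rewrite !inE negb_or li.
  (* Solve [dotv w a] for [w 0 i]: since [a 0 i] is 1 or -1, dividing by it is multiplying by it,
     and the residue is [a 0 i * dotv w a]. *)
  exists (\col_j (- (a 0 i * a 0 (enum_val j)))); split => [j|l il j|].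
  - by rewrite mxE tritN ?tritM.
  - by move: iJ; rewrite il enum_valP.
  - have -> : w 0 i - \sum_(j < #|J|) w 0 (enum_val j) *
        (\col_(j < #|J|) - (a 0 i * a 0 (enum_val j))) j 0 = a 0 i * dotv w a.
      rewrite /dotv (bigD1 i) //= mulrDr mulrCA trit_sqr // mulr1; congr (_ + _).
      rewrite -sumrN (bigID (mem J)) /= [X in _ + X]big1 ?addr0; last first.
        move=> l /andP[li lJ]; rewrite aJ ?mulr0 // !inE negb_or li //.
      rewrite (eq_bigl (mem J)) => [|l]; last first.
        by rewrite andb_idl // => lJ; apply: contraNneq iJ => <-.
      rewrite [in RHS]big_enum_val mulr_sumr; apply: eq_bigr => j _.
      by rewrite mxE; ring.
    rewrite normrM; have /andP[_ ai1] := at' i.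
    move/negP: ab; rewrite -leNgt => ab.
    by rewrite (le_trans _ ab) // ler_piMl.
have [y yP] := choice rel.
exists J, (\matrix_(j, i) y i j 0); split => //.
- by move=> j i; rewrite mxE; have [] := yP i.
- by move=> j l; rewrite mxE; have [_ /(_ l erefl j)] := yP (enum_val l).
- move=> i; have [_ _] := yP i; congr (`|_ - _| <= _).
  by apply: eq_bigr => j _; rewrite mxE.
Qed.

End Dissociated.

(** * The numerical estimate on [beta] *)

Lemma le_truncn_log2 (R : realType) (d : nat) (x : R) :
  2 ^+ d <= x -> (d <= Num.truncn (log2 x))%N.
Proof.
move=> dx; have x0 : 0 < x by apply: lt_le_trans dx; rewrite exprn_gt0.
have ln2 : 0 < ln (2 : R) by rewrite ln_gt0 ?ltr1n.
have dlog : d%:R <= log2 x.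
  by rewrite /log2 ler_pdivlMr // mulr_natl -lnXn // ler_ln ?posrE ?exprn_gt0.
by rewrite truncn_ge_nat // (le_trans _ dlog).
Qed.

Lemma beta_bound_small (R : realType) (n d : nat) (alpha beta : R) :
  (0 < n)%N -> 0 < alpha -> alpha * 2 ^+ d <= 1 -> beta <= beta_bound n alpha ->
  n%:R * (d%:R * (d`!%:R * (2 * n%:R) ^+ d.-1 * (2 * (n%:R + 1))) + 1) * beta < 1.
Proof.
move=> n0 a0 ad; rewrite /beta_bound; set k := Num.truncn _ => betaD.
set X := n%:R * _.
have n1 : 1 <= n%:R :> R by rewrite ler1n.
have dk : (d <= k)%N.
  apply: le_truncn_log2; rewrite ler_pdivlMr // mulrC.
  exact: le_trans ad n1.
have a1 : alpha <= 1.
  by apply: le_trans ad; apply: ler_peMr; rewrite ?(ltW a0) ?exprn_ege1 // ler1n.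
have X0 : 0 <= X.
  by rewrite mulr_ge0 // addr_ge0 // !mulr_ge0 // ?exprn_ge0 ?mulr_ge0 ?addr_ge0.
have np0 : 0 < n%:R ^+ (5 + k) :> R by rewrite exprn_gt0 ?ltr0n.
have f0 : 0 < (2 + k)`!%:R :> R by rewrite ltr0n fact_gt0.
apply: le_lt_trans (ler_wpM2l X0 betaD) _.
rewrite ltr_pdivrMr ?mul1r; last exact: mulr_gt0 (mulr_gt0 (divr_gt0 _ a0) np0) f0.
rewrite -(ltr_pM2l a0).
have -> : alpha * (2 / alpha * n%:R ^+ (5 + k) * (2 + k)`!%:R) =
    2 * n%:R ^+ (5 + k) * (2 + k)`!%:R.
  by rewrite !mulrA [alpha * 2]mulrC mulfK ?gt_eqF.
have Xle : alpha * X <= n%:R * (2 * d%:R * d`!%:R * n%:R ^+ d + 1).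
  rewrite /X mulrCA ler_wpM2l // mulrDr lerD ?mulr1 //.
  (* For [d = 0] the factor [d%:R] vanishes, so the truncated predecessor in the exponent is
     harmless. *)
  case: d ad {dk X X0} => [|d] ad; first by rewrite !mul0r mulr0 mulr0 !mul0r.
  apply: (@le_trans _ _ (alpha * 2 ^+ d.+1 *
    (2 * d.+1%:R * (d.+1)`!%:R * n%:R ^+ d.+1))).
    rewrite -pred_Sn exprMn.
    have -> : alpha * (d.+1%:R * ((d.+1)`!%:R * (2 ^+ d * n%:R ^+ d) * (2 * (n%:R + 1)))) =
      (alpha * 2 ^+ d.+1 * (d.+1%:R * (d.+1)`!%:R * n%:R ^+ d)) * (n%:R + 1).
      by rewrite exprS; ring.
    have -> : alpha * 2 ^+ d.+1 * (2 * d.+1%:R * (d.+1)`!%:R * n%:R ^+ d.+1) =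
      (alpha * 2 ^+ d.+1 * (d.+1%:R * (d.+1)`!%:R * n%:R ^+ d)) * (2 * n%:R).
      by rewrite (exprS n%:R); ring.
    apply: ler_wpM2l; last by rewrite mulr_natl mulr2n lerD2l.
    by rewrite !mulr_ge0 ?exprn_ge0 // ltW.
  by rewrite ler_piMl // !mulr_ge0 ?exprn_ge0.
apply: le_lt_trans Xle _.
have nd1 : 1 <= n%:R ^+ d :> R by rewrite exprn_ege1.
apply: (@lt_le_trans _ _ (2 * n%:R ^+ d.+1 * (d.+1)`!%:R)).
  have f1 : 1 <= d`!%:R :> R by rewrite ler1n fact_gt0.
  rewrite exprS factS natrM -(natr1 d).
  have -> : 2 * (n%:R * n%:R ^+ d) * ((d%:R + 1) * d`!%:R) =
    n%:R * (2 * d%:R * d`!%:R * n%:R ^+ d + 2 * (d`!%:R * n%:R ^+ d)) :> R by ring.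
  rewrite ltr_pM2l ?ltr0n // ltrD2l.
  by rewrite (lt_le_trans (_ : 1 < 2)) ?ltr1n // ler_peMr // mulr_ege1.
apply: ler_pM; [by rewrite mulr_ge0 ?exprn_ge0|by []| |].
  by rewrite ler_wpM2l // ler_weXn2l // addSn ltnS (leq_trans dk) // leq_addl.
by rewrite ler_nat leq_fact // addSn ltnS (leq_trans dk) // leq_addl.
Qed.

(** * The grid {-1,0,1}^n and the construction of the hyperplane *)

Lemma ternary_points_enum (R : realType) (n : nat) :
  exists (m : nat) (p : 'I_m -> 'rV[R]_n), (forall g i, trit R (p g 0 i)) /\
    forall x : 'rV[R]_n, (forall i, [\/ x 0 i = -1, x 0 i = 0 | x 0 i = 1]) ->
      exists g, x = p g.
Proof.
pose pt (g : {ffun 'I_n -> 'I_3}) : 'rV[R]_n := \row_i ((g i)%:R - 1).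
exists #|{ffun 'I_n -> 'I_3}|, (fun h => pt (enum_val h)); split.
  move=> h i; rewrite mxE; case: (enum_val h i) => [[|[|[|//]]]] _ /=.
  - by rewrite sub0r tritN // (trit_nat R true).
  - by rewrite subrr (trit_nat R false).
  - by have -> : 2 - 1 = true%:R :> R; [rewrite /=; ring | rewrite trit_nat].
move=> x x3.
have /choice[g gE] : forall i, exists k : 'I_3, x 0 i = k%:R - 1.
  move=> i; case: (x3 i) => ->.
  - by exists (@Ordinal 3 0 isT); rewrite sub0r.
  - by exists (@Ordinal 3 1 isT); rewrite subrr.
  - by exists (@Ordinal 3 2 isT); rewrite /=; ring.
exists (enum_rank [ffun i => g i]); rewrite enum_rankK.
by apply/rowP => i; rewrite mxE ffunE gE.
Qed.

Theorem theorem45 (R : realType) (n : nat) (w : 'rV[R]_n) (t : R)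
    (S : {set {ffun 'I_n -> bool}}) (alpha beta : R) :
  w != 0 ->
  0 < alpha ->
  (#|S|%:R = alpha * 2 ^+ n) ->
  (forall b, b \in S -> in_nbhd beta w t (pm1 R b)) ->
  0 <= beta -> beta <= beta_bound n alpha ->
  exists (w' : 'rV[R]_n) (t' : R), w' != 0 /\
    forall x : 'rV[R]_n, (in_pm1_cube x \/ in_01_cube x) ->
      in_nbhd beta w t x -> dotv w' x = t'.
Proof.
move=> w0 a0 Scard Snear beta0 betaB.
have [i0 wi0] : exists i, w 0 i != 0.
  exact/rV0Pn.
have n0 : (0 < n)%N by apply: leq_ltn_trans (ltn_ord i0).
have ww0 : 0 < dotv w w.
  rewrite /dotv (bigD1 i0) //= ltr_pwDl //.
    by rewrite -expr2 exprn_even_gt0.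
  by apply: sumr_ge0 => i _; rewrite -expr2 sqr_ge0.
pose s := Num.sqrt (dotv w w); have s0 : 0 < s by rewrite sqrtr_gt0.
(* Scaling by the norm of [w] removes the denominator of [hdist]. *)
have [b bE] : exists b, b = beta * s by exists (beta * s).
have b0 : 0 <= b by rewrite bE mulr_ge0 ?(ltW s0).
have nearE x : in_nbhd beta w t x = (`|dotv w x - t| <= b) :> bool.
  by rewrite /in_nbhd /hdist ler_pdivrMr // bE.
have [J [A [Jdis Atrit AJ Aw]]] := dissociated_lift R n b w b0.
have Jcard : alpha * 2 ^+ #|J| <= 1.
  have SJ : (#|S| <= 2 ^ #|~: J|)%N.
    by apply: (dissociated_card R n b w t J S Jdis) => e /Snear; rewrite nearE.
  rewrite -(@ler_pM2r _ (2 ^+ #|~: J|)) ?exprn_gt0 // mul1r -mulrA -exprD.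
  by rewrite cardsC card_ord -Scard -natrX ler_nat.
have [e0 e0S] : exists e0, e0 \in S.
  apply/set0Pn; rewrite -card_gt0 -(ltr0n R) Scard mulr_gt0 ?exprn_gt0 //.
pose x0 := pm1 R e0.
have x0near : `|dotv w x0 - t| <= b by rewrite -nearE Snear.
have x0trit i : trit R (x0 0 i).
  rewrite mxE; case: (e0 i); rewrite ?tritN //; exact: (trit_nat R true).
(* Both cubes lie in this finite grid, whose points can then index the rows of a matrix. *)
have [m [p [ptrit pP]]] := ternary_points_enum R n.
(* Points outside the neighborhood get the zero vector: their rows impose no condition and satisfy
   every bound. *)
pose del g := if in_nbhd beta w t (p g) then p g - x0 else 0.
have delint g i : del g 0 i \is a Num.int.
  rewrite /del; case: ifP => _; rewrite !mxE ?rpred0 // rpredB //.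
    by have /andP[] := ptrit g i.
  by have /andP[] := x0trit i; rewrite mxE.
have del2 g i : `|del g 0 i| <= 2.
  rewrite /del; case: ifP => _; rewrite !mxE ?normr0 //.
  have /andP[_ p1] := ptrit g i; have /andP[_] := x0trit i; rewrite mxE => x1.
  by apply: le_trans (ler_normB _ _) _; lra.
have delw g : `|dotv w (del g)| <= 2 * b.
  rewrite /del; case: ifPn => [|_].
    rewrite nearE dotvDr dotvNr; move: x0near; rewrite !ler_norml.
    by move=> /andP[? ?] /andP[? ?]; apply/andP; split; lra.
  by rewrite /dotv big1 ?normr0 ?mulr_ge0 // => i _; rewrite mxE mulr0.
pose v : 'cV[R]_#|J| := \col_j w 0 (enum_val j).
pose Z := \matrix_(g < m) del g *m A^T.
have ZE (y : 'cV[R]_#|J|) g :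
    (Z *m y) g 0 = dotv (\row_i \sum_j y j 0 * A j i) (del g).
  rewrite mxE /dotv.
  under eq_bigr do rewrite mxE mulr_suml.
  rewrite exchange_big; apply: eq_bigr => i _; rewrite [in RHS]mxE mulr_suml.
  by apply: eq_bigr => j _; rewrite !mxE; ring.
have Zint g j : Z g j \is a Num.int.
  rewrite mxE rpred_sum // => i _; rewrite !mxE rpredM //.
  by have /andP[] := Atrit j i.
have Zle g j : `|Z g j| <= 2 * n%:R.
  rewrite mxE; apply: le_trans (ler_norm_sum _ _ _) _.
  apply: (@le_trans _ _ (\sum_(i < n) 2)).
    apply: ler_sum => i _; rewrite !mxE normrM -[leRHS]mulr1 ler_pM //.
    by have /andP[] := Atrit j i.
  by rewrite sumr_const card_ord mulr_natr.
(* Replacing [w] by the combination of rows of [A] with coefficients [v] costs at most [b] per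
   coordinate, hence [2 * n%:R * b] in all; [delw] contributes the other [2 * b]. *)
have Zv g : `|(Z *m v) g 0| <= 2 * (n%:R + 1) * b.
  have -> : (Z *m v) g 0 = dotv w (del g) -
      \sum_i (w 0 i - \sum_j w 0 (enum_val j) * A j i) * del g 0 i.
    rewrite ZE /dotv -sumrB; apply: eq_bigr => i _; rewrite mxE.
    under eq_bigr do rewrite mxE.
    by ring.
  apply: le_trans (ler_normB _ _) _.
  suff : `|\sum_i (w 0 i - \sum_j w 0 (enum_val j) * A j i) * del g 0 i| <=
    b * 2 * n%:R by move: (delw g); lra.
  apply: le_trans (ler_norm_sum _ _ _) _.
  apply: (@le_trans _ _ (\sum_(i < n) (b * 2))).
    by apply: ler_sum => i _; rewrite normrM ler_pM.
  by rewrite sumr_const card_ord -[leLHS]mulr_natr.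
have [[v' v'0 Zv']|vle] := annihilator_or_small R m #|J| Z v _ _ Zint Zle Zv.
  pose w' : 'rV[R]_n := \row_i \sum_j v' j 0 * A j i.
  exists w', (dotv w' x0); split.
    (* The identity block of [A] reads the entries of [v'] off [w']. *)
    apply: contraNneq v'0 => w'0; apply/eqP/colP => l.
    have := congr1 (fun u : 'rV[R]_n => u 0 (enum_val l)) w'0.
    rewrite !mxE (bigD1 l) //= AJ eqxx mulr1 big1 ?addr0 // => j /negPf jl.
    by rewrite AJ jl mulr0.
  move=> x xcube xnear.
  have [|g xE] := pP x.
    move=> i; case: xcube => /(_ i) [] ->; by [constructor 1|constructor 2|constructor 3].
  have /matrixP/(_ g 0) := Zv'; rewrite ZE mxE /del -xE xnear.
  by rewrite dotvDr dotvNr => /eqP; rewrite subr_eq0 => /eqP.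
(* Cramer's bound summed over [J], plus 1 for the approximation error [Aw]. *)
pose C := #|J|%:R * ((#|J|)`!%:R * (2 * n%:R) ^+ #|J|.-1 * (2 * (n%:R + 1))) + 1 : R.
have C0 : 0 <= C.
  by rewrite addr_ge0 // !mulr_ge0 // ?exprn_ge0 ?mulr_ge0 ?addr_ge0.
have wC i : `|w 0 i| <= C * b.
  have : `|\sum_j w 0 (enum_val j) * A j i| <= (C - 1) * b.
    apply: le_trans (ler_norm_sum _ _ _) _.
    apply: (@le_trans _ _ (\sum_(j < #|J|)
        (#|J|)`!%:R * (2 * n%:R) ^+ #|J|.-1 * (2 * (n%:R + 1) * b))).
      apply: ler_sum => j _; have /andP[_ A1] := Atrit j i.
      have := vle j; rewrite mxE => vj.
      by rewrite normrM -[leRHS]mulr1 ler_pM.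
    by rewrite sumr_const card_ord -[leLHS]mulr_natl /C addrK !mulrA.
  by have := Aw i; rewrite !ler_norml => /andP[? ?] /andP[? ?]; apply/andP; split; lra.
have small : n%:R * C * beta < 1 by exact: (beta_bound_small R n #|J| alpha beta).
(* Summing the squared coordinate bounds gives a factor [n%:R], relaxed to [n%:R ^+ 2]; as
   [n%:R * C * beta < 1] and [dotv w w > 0], this is a contradiction. *)
have : dotv w w <= (n%:R * C * beta) ^+ 2 * dotv w w.
  apply: (@le_trans _ _ (\sum_(i < n) (C * b) ^+ 2)).
    apply: ler_sum => i _; rewrite -expr2 -real_normK ?num_real //.
    by rewrite lerXn2r ?nnegrE ?mulr_ge0.
  rewrite sumr_const card_ord -[leLHS]mulr_natl bE !exprMn sqr_sqrtr ?(ltW ww0) //.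
  have -> : n%:R ^+ 2 * C ^+ 2 * beta ^+ 2 * dotv w w =
    n%:R * (n%:R * (C ^+ 2 * (beta ^+ 2 * dotv w w))) by ring.
  by rewrite ler_peMl ?ler1n // !mulr_ge0 ?sqr_ge0 // ltW.
rewrite leNgt => /negP[]; rewrite gtr_pMl //.
by rewrite expr_lt1 // !mulr_ge0.
Qed.
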